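(* Let $(\mathcal A,\prec,\succ,\alpha)$ be a Hom-anti-dendriform superalgebra. Define the bilinear map $\cdot:\mathcal A\times\mathcal A\to\mathcal A$ by $x\cdot y=x\prec y+x\succ y$. Then $(\mathcal A,\cdot,\alpha)$ is a Hom-associative superalgebra with a representation $(\mathcal A,-\mathfrak L_\prec,-\mathfrak R_\succ,\alpha)$, where $\mathfrak L_\prec,\mathfrak R_\succ:\mathcal A\to \mathrm{End}(\mathcal A)$ are the even linear maps defined on homogeneous elements by $\mathfrak L_\prec(x)y=x\prec y$ and $\mathfrak R_\succ(x)y=(-1)^{|x||y|}\,y\succ x$.
   Context: All vector spaces are finite-dimensional over a field $\mathbb F$ of characteristic $0$ and $\mathbb Z_2$-graded; $|x|$ is the degree of a homogeneous element $x$; all identities are required for homogeneous elements. Even (bi)linear maps preserve degrees; $\mathrm{End}(V)$ is graded in the usual way. A Hom-anti-dendriform superalgebra is $(\mathcal A,\prec,\succ,\alpha)$ with $\mathcal A$ a $\mathbb Z_2$-graded vector space, $\prec,\succ:\mathcal A\times\mathcal A\to\mathcal A$ even bilinear, $\alpha:\mathcal A\to\mathcal A$ even linear, such that, with $x\cdot y=x\prec y+x\succ y$, for all $x,y,z$: $\alpha(x)\prec(y\prec z)=-(x\cdot y)\prec\alpha(z)=-\alpha(x)\succ(y\cdot z)=(x\succ y)\succ\alpha(z)$ and $(x\prec y)\succ\alpha(z)=\alpha(x)\prec(y\succ z)$. A Hom-associative superalgebra is $(\mathcal A,\mu,\alpha)$ with $\mathcal A$ a $\mathbb Z_2$-graded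 vector space, $\mu$ even bilinear, $\alpha$ even linear and $\mu(\mu(x,y),\alpha(z))=\mu(\alpha(x),\mu(y,z))$ for all $x,y,z$. A representation of $(\mathcal A,\mu,\alpha)$ is $(V,\mathfrak l,\mathfrak r,\beta)$ with $V$ a $\mathbb Z_2$-graded vector space, $\beta:V\to V$ even linear, $\mathfrak l,\mathfrak r:\mathcal A\to \mathrm{End}(V)$ even linear, such that for all homogeneous $x,y\in\mathcal A$: $\beta\mathfrak l(x)=\mathfrak l(\alpha(x))\beta$; $\beta\mathfrak r(x)=\mathfrak r(\alpha(x))\beta$; $\mathfrak l(\mu(x,y))\beta=\mathfrak l(\alpha(x))\mathfrak l(y)$; $\mathfrak r(\mu(x,y))\beta=(-1)^{|x||y|}\mathfrak r(\alpha(y))\mathfrak r(x)$; $\mathfrak l(\alpha(x))\mathfrak r(y)=(-1)^{|x||y|}\mathfrak r(\alpha(y))\mathfrak l(x)$.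
   Formalization: For the representation claim only, α is additionally assumed multiplicative for ≺ and ≻, i.e. α(x≺y)=α(x)≺α(y) and α(x≻y)=α(x)≻α(y); this is equivalent to the two compatibility conditions with β=α and does not follow from the given axioms. *)

(* Defs.v *)
From HB Require Import structures.
From mathcomp Require Import all_boot all_order all_algebra.

Set Implicit Arguments.
Unset Strict Implicit.
Unset Printing Implicit Defensive.

Import GRing.Theory.
Local Open Scope ring_scope.

Record superspace (F : fieldType) := Superspace {
  carrier :> vectType F;
  hcomp : 'Z_2 -> {vspace carrier};
  hcomp_direct : directv (\sum_(i : 'Z_2) hcomp i);
  hcomp_full : (\sum_(i : 'Z_2) hcomp i)%VS = fullv
}.

(* The component of degree i of a vector. *)
Definition hproj (F : fieldType) (V : superspace F) (i : 'Z_2) (v : V) : V :=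
  sumv_pi_for (esym (hcomp_full V)) i v.

Definition even_map (F : fieldType) (V : superspace F) (f : 'End(V)) : Prop :=
  forall (i : 'Z_2) (v : V), v \in hcomp V i -> f v \in hcomp V i.

Definition end_degree (F : fieldType) (V : superspace F) (i : 'Z_2)
    (f : 'End(V)) : Prop :=
  forall (j : 'Z_2) (v : V), v \in hcomp V j -> f v \in hcomp V (i + j).

Definition even_to_End (F : fieldType) (A V : superspace F)
    (l : A -> 'End(V)) : Prop :=
  forall (i : 'Z_2) (x : A), x \in hcomp A i -> end_degree i (l x).

Definition is_bilinear (F : fieldType) (A : superspace F)
    (op : A -> A -> A) : Prop :=
  (forall x : A, linear (op x)) /\ (forall y : A, linear (op^~ y)).

Definition even_op (F : fieldType) (A : superspace F)
    (op : A -> A -> A) : Prop :=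
  forall (i j : 'Z_2) (x y : A),
    x \in hcomp A i -> y \in hcomp A j -> op x y \in hcomp A (i + j).

Definition dot (F : fieldType) (A : superspace F) (prec succ : A -> A -> A)
    (x y : A) : A :=
  prec x y + succ x y.

Record hom_anti_dendriform (F : fieldType) (A : superspace F)
    (prec succ : A -> A -> A) (alpha : 'End(A)) : Prop := {
  had_prec_bilinear : is_bilinear prec;
  had_succ_bilinear : is_bilinear succ;
  had_prec_even : even_op prec;
  had_succ_even : even_op succ;
  had_alpha_even : even_map alpha;
  had_eq1 : forall x y z : A,
    prec (alpha x) (prec y z) = - prec (dot prec succ x y) (alpha z);
  had_eq2 : forall x y z : A,
    - prec (dot prec succ x y) (alpha z)
    = - succ (alpha x) (dot prec succ y z);
  had_eq3 : forall x y z : A,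
    - succ (alpha x) (dot prec succ y z) = succ (succ x y) (alpha z);
  had_eq4 : forall x y z : A,
    succ (prec x y) (alpha z) = prec (alpha x) (succ y z)
}.

Record hom_associative (F : fieldType) (A : superspace F)
    (mu : A -> A -> A) (alpha : 'End(A)) : Prop := {
  ha_bilinear : is_bilinear mu;
  ha_even : even_op mu;
  ha_alpha_even : even_map alpha;
  ha_assoc : forall x y z : A, mu (mu x y) (alpha z) = mu (alpha x) (mu y z)
}.

(* Not implied by hom_anti_dendriform, yet needed for (and equivalent to) the
   compatibilities rep_beta_l and rep_beta_r of left_mul and right_mul. *)
Definition multiplicative_for (F : fieldType) (A : superspace F)
    (op : A -> A -> A) (alpha : 'End(A)) : Prop :=
  forall x y : A, alpha (op x y) = op (alpha x) (alpha y).

(* The exponent i * j is computed in 'Z_2 and then read as a natural number. *)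
Record representation (F : fieldType) (A V : superspace F)
    (mu : A -> A -> A) (alpha : 'End(A))
    (l r : A -> 'End(V)) (beta : 'End(V)) : Prop := {
  rep_beta_even : even_map beta;
  rep_l_linear : linear l;
  rep_r_linear : linear r;
  rep_l_even : even_to_End l;
  rep_r_even : even_to_End r;
  rep_beta_l : forall (i : 'Z_2) (x : A), x \in hcomp A i ->
    (beta \o l x)%VF = (l (alpha x) \o beta)%VF;
  rep_beta_r : forall (i : 'Z_2) (x : A), x \in hcomp A i ->
    (beta \o r x)%VF = (r (alpha x) \o beta)%VF;
  rep_l_mu : forall (i j : 'Z_2) (x y : A),
    x \in hcomp A i -> y \in hcomp A j ->
    (l (mu x y) \o beta)%VF = (l (alpha x) \o l y)%VF;
  rep_r_mu : forall (i j : 'Z_2) (x y : A),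
    x \in hcomp A i -> y \in hcomp A j ->
    (r (mu x y) \o beta)%VF = (-1) ^+ (i * j)%R *: (r (alpha y) \o r x)%VF;
  rep_l_r : forall (i j : 'Z_2) (x y : A),
    x \in hcomp A i -> y \in hcomp A j ->
    (l (alpha x) \o r y)%VF = (-1) ^+ (i * j)%R *: (r (alpha y) \o l x)%VF
}.

(* linfun is only meaningful on linear functions: the operators below are the
   intended ones when op is bilinear, see left_mulE and right_mulE. *)
Definition left_mul (F : fieldType) (A : superspace F)
    (op : A -> A -> A) (x : A) : 'End(A) :=
  linfun (op x).

(* Bilinear extension of x, y |-> (-1)^(|x||y|) op y x. *)
Definition right_mul (F : fieldType) (A : superspace F)
    (op : A -> A -> A) (x : A) : 'End(A) :=
  linfun (fun y : A => \sum_(i : 'Z_2) \sum_(j : 'Z_2)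
    (-1) ^+ (i * j)%R *: op (hproj j y) (hproj i x)).

Lemma linfun_linE (F : fieldType) (U V : vectType F) (f : U -> V) :
  linear f -> linfun f =1 f.
Proof.
move=> fl; pose M := GRing.isLinear.Build F U V _ f fl.
pose g : {linear U -> V} := HB.pack f M.
by move=> x; rewrite -[RHS](lfunE g).
Qed.

Lemma left_mulE (F : fieldType) (A : superspace F) (op : A -> A -> A)
    (x y : A) :
  is_bilinear op -> left_mul op x y = op x y.
Proof. by case=> opr _; exact: linfun_linE. Qed.

Lemma hproj_homog (F : fieldType) (A : superspace F) (i k : 'Z_2) (x : A) :
  x \in hcomp A i -> hproj k x = if k == i then x else 0.
Proof.
move=> xi; pose u k := if k == i then x else 0 : A.
have hu k' : u k' \in hcomp A k'.
  by rewrite /u; case: eqP => [->|_]; rewrite ?mem0v.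
have hp k' : hproj k' x \in hcomp A k' by apply: memv_sum_pi.
have /directv_sum_unique U := hcomp_direct A.
have := U (fun k => hproj k x) u (fun k _ => hp k) (fun k _ => hu k).
have -> : \sum_k hproj k x = x by apply: sumv_pi_sum; rewrite ?memvf.
have -> : \sum_k u k = x.
  by rewrite (bigD1 i) //= big1 => [|j /negPf ji]; rewrite /u ?eqxx ?addr0 // ji.
by rewrite eqxx => /esym /forall_inP /(_ k isT) /eqP ->.
Qed.

Lemma right_mulE (F : fieldType) (A : superspace F) (op : A -> A -> A)
    (i j : 'Z_2) (x y : A) :
  is_bilinear op -> x \in hcomp A i -> y \in hcomp A j ->
  right_mul op x y = (-1) ^+ (i * j)%R *: op y x.
Proof.
case=> opr opl xi yj; rewrite /right_mul linfun_linE; last first.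
  move=> a u v; rewrite scaler_sumr -big_split; apply: eq_bigr => m _ /=.
  rewrite scaler_sumr -big_split; apply: eq_bigr => n _ /=.
  by rewrite /hproj linearP opl scalerDr !scalerA (mulrC a).
have op0l z : op 0 z = 0.
  by have := opl z (-1) 0 0; rewrite /= scaler0 addr0 scaleN1r addNr.
have op0r z : op z 0 = 0.
  by have := opr z (-1) 0 0; rewrite /= scaler0 addr0 scaleN1r addNr.
rewrite (bigD1 i) //= (bigD1 j) //=.
rewrite !(hproj_homog _ xi) !(hproj_homog _ yj) !eqxx.
rewrite big1 => [|k /negPf kj]; last first.
  by rewrite (hproj_homog _ yj) kj op0l scaler0.
rewrite addr0 big1 ?addr0 // => k /negPf ki.
by rewrite big1 // => m _; rewrite (hproj_homog _ xi) ki op0r scaler0.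
Qed.

(* Main.v *)
Require Import Defs.
From mathcomp Require Import all_boot all_order all_algebra.

Set Implicit Arguments.
Unset Strict Implicit.
Unset Printing Implicit Defensive.

Import GRing.Theory.
Local Open Scope ring_scope.

(** The four terms of the first chain of axioms are, up to sign, one element
    [p] of [A]; the two terms of the remaining axiom are one element [q].  Both
    sides of Hom-associativity, once expanded, are sums of terms [p], [-p] and
    [q] in which [p] cancels, so both equal [q] ([dot_hom_assoc]).

    For the representation, an equation between endomorphisms may be tested on
    a vector [v] that is homogeneous, say of degree [k] ([eq_homog_End]).  On
    such a vector the graded operator [right_mul succ] is [succ] with its
    arguments exchanged and one sign ([right_mulE]), so each condition on
    products becomes one axiom, applied to a permutation of [x], [y] and [v],
    together with an equality of Koszul signs.  The two signs that occur are
    [(i + j) k = i j + j (i + k) + i k] and [j k = i j + j (i + k)] modulo 2,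
    where [i], [j] are the degrees of [x], [y]: in both, [i j] occurs twice.
    The commutation of the operators with [alpha] is multiplicativity of
    [alpha], with no sign change because [alpha] is even. *)

(** Degrees are added in ['Z_2], where [1 + 1 = 0], while exponents are natural
    numbers; the two agree because [(-1) ^+ 2 = 1]. *)
Lemma signZ2D (R : pzRingType) (i j : 'Z_2) :
  (-1) ^+ (i + j)%R = (-1) ^+ i * (-1) ^+ j :> R.
Proof.
rewrite -exprD -[RHS]signr_odd -[LHS]signr_odd; congr ((-1) ^+ nat_of_bool _).
by case: i j => [[|[|[]]] //= ?] [[|[|[]]] //= ?].
Qed.

Lemma signZ2_sq (R : pzRingType) (i : 'Z_2) :
  (-1) ^+ i * (-1) ^+ i = 1 :> R.
Proof. by rewrite -expr2 sqrr_sign. Qed.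

(** The first factor comes from exchanging [x] and [y] in an axiom, the second
    from a right multiplication by [y] acting on an image of [v] under a
    multiplication by [x]; here [x], [y], [v] have degrees [i], [j], [k]. *)
Lemma koszul_cancel (R : comPzRingType) (i j k : 'Z_2) :
  (-1) ^+ (i * j)%R * (-1) ^+ (j * (i + k))%R = (-1) ^+ (j * k)%R :> R.
Proof. by rewrite mulrDr signZ2D mulrA (mulrC j i) signZ2_sq mul1r. Qed.

(** The homogeneous components span, so they separate linear maps. *)
Lemma eq_homog_End (F : fieldType) (V : superspace F) (f g : 'End(V)) :
  (forall (k : 'Z_2) (v : V), v \in hcomp V k -> f v = g v) -> f = g.
Proof.
move=> fg; apply/lfunP => v.
have /memv_sumP [u hu ->] : v \in (\sum_(k : 'Z_2) hcomp V k)%VS.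
  by rewrite hcomp_full memvf.
by rewrite !linear_sum; apply: eq_bigr => k _; apply: fg (hu k isT).
Qed.

Lemma end_degreeN (F : fieldType) (V : superspace F) (i : 'Z_2) (f : 'End(V)) :
  end_degree i f -> end_degree i (- f).
Proof. by move=> fi j v vj; rewrite opp_lfunE rpredN; apply: fi. Qed.

Lemma linear_oppl (F : fieldType) (U V : lmodType F) (f : U -> V) :
  linear f -> linear (fun x => - f x).
Proof. by move=> fl a x y; rewrite /= fl opprD scalerN. Qed.

Section Bilinear.

Variables (F : fieldType) (A : superspace F) (op : A -> A -> A).
Hypothesis op_bilin : is_bilinear op.

Lemma bilinDl x y z : op (x + y) z = op x z + op y z.
Proof. by have := op_bilin.2 z 1 x y; rewrite /= !scale1r. Qed.

Lemma bilinDr x y z : op x (y + z) = op x y + op x z.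
Proof. by have := op_bilin.1 x 1 y z; rewrite !scale1r. Qed.

Lemma bilin0l z : op 0 z = 0.
Proof. by apply: (addrI (op 0 z)); rewrite -bilinDl !addr0. Qed.

Lemma bilin0r x : op x 0 = 0.
Proof. by apply: (addrI (op x 0)); rewrite -bilinDr !addr0. Qed.

Lemma bilinZl a x z : op (a *: x) z = a *: op x z.
Proof.
by have := op_bilin.2 z a x 0; rewrite /= !addr0 bilin0l addr0.
Qed.

Lemma bilinZr a x z : op x (a *: z) = a *: op x z.
Proof. by have := op_bilin.1 x a z 0; rewrite !addr0 bilin0r addr0. Qed.

Lemma bilinNl x z : op (- x) z = - op x z.
Proof. by rewrite -!scaleN1r bilinZl. Qed.

Lemma bilinNr x z : op x (- z) = - op x z.
Proof. by rewrite -!scaleN1r bilinZr. Qed.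

Lemma left_mul_linear : linear (left_mul op).
Proof.
move=> a x y; apply/lfunP => v.
by rewrite add_lfunE scale_lfunE !left_mulE // bilinDl bilinZl.
Qed.

Lemma right_mul_sumE x y :
  right_mul op x y = \sum_(i : 'Z_2) \sum_(j : 'Z_2)
    (-1) ^+ (i * j)%R *: op (hproj j y) (hproj i x).
Proof.
rewrite /right_mul linfun_linE // => a u v.
rewrite scaler_sumr -big_split; apply: eq_bigr => m _ /=.
rewrite scaler_sumr -big_split; apply: eq_bigr => n _ /=.
by rewrite /hproj linearP bilinDl bilinZl scalerDr !scalerA (mulrC a).
Qed.

Lemma right_mul_linear : linear (right_mul op).
Proof.
move=> a x y; apply/lfunP => v; rewrite add_lfunE scale_lfunE !right_mul_sumE.
rewrite scaler_sumr -big_split; apply: eq_bigr => m _ /=.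
rewrite scaler_sumr -big_split; apply: eq_bigr => n _ /=.
by rewrite /hproj linearP bilinDr bilinZr scalerDr !scalerA (mulrC a).
Qed.

Hypothesis op_even : even_op op.

Lemma left_mul_even : even_to_End (left_mul op).
Proof. by move=> i x xi j v vj; rewrite left_mulE //; apply: op_even. Qed.

Lemma right_mul_even : even_to_End (right_mul op).
Proof.
move=> i x xi j v vj; rewrite (right_mulE op_bilin xi vj) memvZ //.
by rewrite addrC; apply: op_even.
Qed.

End Bilinear.


Section HomAntiDendriform.

Variables (F : fieldType) (A : superspace F).
Variables (prec succ : A -> A -> A) (alpha : 'End(A)).
Hypothesis hA : hom_anti_dendriform prec succ alpha.

Let mu := dot prec succ.
Let precB : is_bilinear prec := had_prec_bilinear hA.
Let succB : is_bilinear succ := had_succ_bilinear hA.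
Let alphaE : even_map alpha := had_alpha_even hA.

Lemma dot_bilinear : is_bilinear mu.
Proof.
split=> z a x y; rewrite /mu /dot /=.
  by rewrite precB.1 succB.1 scalerDr addrACA.
by rewrite precB.2 succB.2 scalerDr addrACA.
Qed.

Lemma dot_even : even_op mu.
Proof.
move=> i j x y xi yj; apply: rpredD.
  exact: had_prec_even hA _ _ _ _ xi yj.
exact: had_succ_even hA _ _ _ _ xi yj.
Qed.

(** With [p = prec (mu x y) (alpha z)] and [q = prec (alpha x) (succ y z)], the
    left side expands to [p + (q - p)] and the right side to [- p + q + p]. *)
Lemma dot_hom_assoc x y z : mu (mu x y) (alpha z) = mu (alpha x) (mu y z).
Proof.
have e1 := had_eq1 hA x y z; have e2 := had_eq2 hA x y z.
have e3 := had_eq3 hA x y z; have e4 := had_eq4 hA x y z.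
rewrite -/mu in e1 e2 e3.
rewrite {1 3}/mu /dot -/(mu x y) -/(mu y z).
rewrite {2}/mu {3}/mu /dot (bilinDl succB) (bilinDr precB).
rewrite -e3 e4 e1 -e2.
set p := prec (mu x y) (alpha z); set q := prec _ _.
have -> : succ (alpha x) (mu y z) = p by apply: oppr_inj; rewrite -e2.
by rewrite addrCA subrr addr0 addrAC addNr add0r.
Qed.

Lemma dot_hom_associative : hom_associative mu alpha.
Proof.
by split; [exact: dot_bilinear | exact: dot_even | | exact: dot_hom_assoc].
Qed.

Let l x := - left_mul prec x.
Let r x := - right_mul succ x.

Let lE x v : l x v = - prec x v.
Proof. by rewrite opp_lfunE left_mulE. Qed.

Let rE i k x v : x \in hcomp A i -> v \in hcomp A k ->
  r x v = - ((-1) ^+ (i * k)%R *: succ v x).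
Proof. by move=> xi vk; rewrite opp_lfunE (right_mulE succB xi vk). Qed.

(** Each representation axiom has one minus sign per operator, so the two sides
    differ by a sign when [l] or [r] occurs once on the left and twice on the
    right; that sign is the one in the defining chain. *)
Lemma left_right_mul_representation :
  multiplicative_for prec alpha -> multiplicative_for succ alpha ->
  representation (V := A) mu alpha l r alpha.
Proof.
move=> precM succM; split=> //.
- exact/linear_oppl/left_mul_linear.
- exact/linear_oppl/right_mul_linear.
- move=> i x xi; apply: end_degreeN.
  by apply: left_mul_even xi => //; apply: had_prec_even hA.
- move=> i x xi; apply: end_degreeN.
  by apply: right_mul_even xi => //; apply: had_succ_even hA.
- by move=> i x xi; apply/lfunP => v; rewrite !comp_lfunE !lE linearN /= precM.
- move=> i x xi; apply: eq_homog_End => k v vk; rewrite !comp_lfunE.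
  by rewrite (rE xi vk) (rE (alphaE xi) (alphaE vk)) linearN linearZ /= succM.
- move=> i j x y xi yj; apply/lfunP => v; rewrite !comp_lfunE !lE.
  by rewrite (bilinNr precB) opprK (had_eq1 hA).
- move=> i j x y xi yj; apply: eq_homog_End => k v vk.
  have rxv : r x v \in hcomp A (i + k).
    by rewrite (rE xi vk) rpredN memvZ // addrC (had_succ_even hA vk xi).
  rewrite scale_lfunE !comp_lfunE (rE (dot_even xi yj) (alphaE vk)).
  rewrite (rE (alphaE yj) rxv) (rE xi vk) (bilinNl succB) (bilinZl succB).
  rewrite -scalerN (had_eq3 hA) !scalerN opprK !scalerA koszul_cancel.
  by rewrite -signZ2D -mulrDl (addrC j).
- move=> i j x y xi yj; apply: eq_homog_End => k v vk.
  have lxv : l x v \in hcomp A (i + k).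
    by rewrite lE rpredN (had_prec_even hA xi vk).
  rewrite scale_lfunE !comp_lfunE lE (rE yj vk) (rE (alphaE yj) lxv) lE.
  rewrite (bilinNr precB) (bilinZr precB) (bilinNl succB) !scalerN !opprK.
  by rewrite scalerA koszul_cancel (had_eq4 hA).
Qed.

End HomAntiDendriform.

Theorem theorem3p1 (F : fieldType) (charF0 : [pchar F] =i pred0)
    (A : superspace F) (prec succ : A -> A -> A) (alpha : 'End(A))
    (hA : hom_anti_dendriform prec succ alpha) :
  hom_associative (dot prec succ) alpha /\
  (multiplicative_for prec alpha -> multiplicative_for succ alpha ->
   representation (V := A) (dot prec succ) alpha
     (fun x : A => - left_mul prec x) (fun x : A => - right_mul succ x) alpha).
Proof.
split; first exact: dot_hom_associative.
exact: left_right_mul_representation.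
Qed.
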